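(* Let the polynomials $R_i(x;\boldsymbol\rho)$ and the modified data $(\overline x,\overline{\boldsymbol\rho})$ be chosen such that $\lambda_{x,\boldsymbol\rho}=\zeta\lambda_{\overline x,\overline{\boldsymbol\rho}}-\xi$ for parameters $\zeta,\xi$. Then there are coefficients $\lambda^-_{x,\boldsymbol\rho}$ (independent of $i$) and $\Phi^{1,-}_i,\Phi^{0,-}_i$ (independent of $x$), with $\Phi^{0,-}_0\neq0$, such that $$\lambda^-_{x,\boldsymbol\rho} R_{i}(\overline x;\overline{\boldsymbol\rho})=\Phi_{i}^{1,-}R_{i+1}(x;\boldsymbol\rho)+ \Phi_{i}^{0,-}R_{i}(x;\boldsymbol\rho),\qquad i\ge0,$$ if and only if, up to a global normalization, the coefficients are $$\lambda^-_{x,\boldsymbol\rho}=(A_{0,\boldsymbol\rho}-\zeta A_{0,\overline{\boldsymbol\rho}}-\xi)\left(\frac{\lambda_{x,\boldsymbol\rho}}{A_{0,\boldsymbol\rho}}+1\right)+C_{1,\boldsymbol\rho},$$ $$\Phi_{i}^{1,-}=(A_{0,\boldsymbol\rho}-\zeta A_{0,\overline{\boldsymbol\rho}}-\xi)\,\zeta^{-i}\prod_{k=1}^{i}\frac{A_{k,\boldsymbol\rho}}{A_{k-1,\overline{\boldsymbol\rho}}},\qquad \Phi_{i}^{0,-}=\zeta^iC_{1,\boldsymbol\rho}\prod_{k=1}^{i}\frac{C_{k,\overline{\boldsymbol\rho}}}{C_{k,\boldsymbol\rho}},\qquad i\ge0,$$ and the constraints $(\mathfrak C_{A_2})$ are 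satisfied.
   Context: $R_i(x;\boldsymbol\rho)$, $i=0,1,\dots,N$, denotes the polynomials of a finite family of the ($q$-)Askey scheme; $\boldsymbol\rho$ is the list of parameters, which includes the non-negative integer $N$. $R_i(x;\boldsymbol\rho)$ is a polynomial of degree $i$ in the variable $\lambda_{x,\boldsymbol\rho}$, normalized by $R_0(x;\boldsymbol\rho)=R_i(0;\boldsymbol\rho)=1$, and satisfies $$\lambda_{x,\boldsymbol\rho}R_i(x;\boldsymbol\rho)=A_{i,\boldsymbol\rho}R_{i+1}(x;\boldsymbol\rho)-(A_{i,\boldsymbol\rho}+C_{i,\boldsymbol\rho})R_i(x;\boldsymbol\rho)+C_{i,\boldsymbol\rho}R_{i-1}(x;\boldsymbol\rho),\qquad C_{0,\boldsymbol\rho}=0,\ A_{N,\boldsymbol\rho}=0.$$ $\overline{\boldsymbol\rho}$ is a list of modified parameters (of the same family) and $\overline x=x+\eta$ with $\eta\in\{0,+1,-1\}$. Notation: $X_{i,\boldsymbol\rho}:=A_{i-1,\boldsymbol\rho}C_{i,\boldsymbol\rho}$, $Y_{i,\boldsymbol\rho}:=-(A_{i,\boldsymbol\rho}+C_{i,\boldsymbol\rho})$, with $X_{0,\boldsymbol\rho}=0$. Parameters are generic, so that the denominators which occur do not vanish. The constraints $(\mathfrak C_{A_2})$: the two expressions $$\zeta^{2i}\frac{\zeta Y_{i,\overline{\boldsymbol\rho}}-Y_{i,\boldsymbol\rho}-\xi}{X_{i+1,\boldsymbol\rho}-\zeta^2X_{i,\overline{\boldsymbol\rho}}}\prod_{k=1}^{i}\frac{X_{k,\overline{\boldsymbol\rho}}}{X_{k,\boldsymbol\rho}},\qquad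 \zeta^{2i}\frac{X_{i+1,\boldsymbol\rho}-\zeta^{2}X_{i+1,\overline{\boldsymbol\rho}}}{(\zeta Y_{i,\overline{\boldsymbol\rho}}-Y_{i+1,\boldsymbol\rho}-\xi)X_{i+1,\boldsymbol\rho}}\prod_{k=1}^{i}\frac{X_{k,\overline{\boldsymbol\rho}}}{X_{k,\boldsymbol\rho}}$$ are equal and independent of $i$ for $i\ge0$.
   Formalization: With N̄ the size in the modified parameters, i runs over 0..N̄ (i<N in the second constraint) and x over 0..N; added: N̄≤N, and fewer than N̄ points x in 0..N have x+η outside 0..N̄. Otherwise the equivalence fails (e.g. N=N̄=1, η=1) or is undefined. *)

(* Defs.v *)
From mathcomp Require Import all_boot all_order all_algebra.

Set Implicit Arguments.
Unset Strict Implicit.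
Unset Printing Implicit Defensive.

Import GRing.Theory Num.Theory.
Local Open Scope ring_scope.

(* The data of a family of polynomials indexed by a parameter list rho : par.
   [lam rho x] is the variable lambda_{x,rho}; [poly_of rho i] is R_i(.; rho)
   as a polynomial in that variable.  Only the indices 0 <= i <= N, with
   N = size_of rho, are meaningful. *)
Record poly_family (F : fieldType) := PolyFamily {
  par : Type;
  size_of : par -> nat;
  lam : par -> int -> F;
  coefA : par -> nat -> F;
  coefC : par -> nat -> F;
  poly_of : par -> nat -> {poly F}
}.

Definition on_grid (n : nat) (x : int) : bool := (0 <= x) && (x <= n%:Z).

Section Family.
Variables (F : fieldType) (fam : poly_family F).
Implicit Types (rho rhob : par fam) (i k : nat) (x : int).

(* R_i(x; rho).  There is no R_{N+1} in a finite family: the value 0 for i > N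
   says that a term in R_{N+1} is absent, as it is when it carries A_N = 0. *)
Definition Rval rho i x : F :=
  if (i <= size_of rho)%N then (poly_of rho i).[lam rho x] else 0.

(* X_0 = 0 because coefC rho 0 = 0 for the parameters considered below. *)
Definition Xc rho i : F := coefA rho i.-1 * coefC rho i.
Definition Yc rho i : F := - (coefA rho i + coefC rho i).

(* rho is a generic parameter list of a finite family.  The recurrence holds on
   the grid x = 0, ..., N only, since for i = N it expresses that the
   polynomial of degree N + 1 which would come next vanishes there.  For i < N
   both sides have degree at most N, so that it is then an identity of
   polynomials.  At i = 0 the index i.-1 is harmless as coefC rho 0 = 0. *)
Record finite_family_at rho : Prop := FiniteFamilyAt {
  size_poly_of : forall i, (i <= size_of rho)%N -> size (poly_of rho i) = i.+1;
  poly_of_0 : poly_of rho 0 = 1;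
  Rval_at_0 : forall i, (i <= size_of rho)%N -> Rval rho i 0 = 1;
  coefC_0 : coefC rho 0 = 0;
  coefA_N : coefA rho (size_of rho) = 0;
  recurrence : forall i x, (i <= size_of rho)%N -> on_grid (size_of rho) x ->
    lam rho x * Rval rho i x =
      coefA rho i * Rval rho i.+1 x
      - (coefA rho i + coefC rho i) * Rval rho i x
      + coefC rho i * Rval rho i.-1 x;
  lam_inj : forall x y, on_grid (size_of rho) x -> on_grid (size_of rho) y ->
    lam rho x = lam rho y -> x = y;
  Xc_neq0 : forall k, (0 < k <= size_of rho)%N -> Xc rho k != 0
}.

(* The number of points x of the grid of rho such that x + eta is not on the
   grid of rhob. *)
Definition lost_points rho rhob (eta : int) : nat :=
  #|[set x : 'I_(size_of rho).+1 | ~~ on_grid (size_of rhob) (x%:Z + eta)]|.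

(* The index i ranges over that of R_i(.; rhob), i.e. 0 <= i <= size_of rhob;
   the coefficient Phi1 i occurs only for i < size_of rho. *)
Definition contiguity rho rhob (eta : int)
    (lamm : int -> F) (Phi1 Phi0 : nat -> F) : Prop :=
  forall i x, (i <= size_of rhob)%N -> on_grid (size_of rho) x ->
    lamm x * Rval rhob i (x + eta) =
      Phi1 i * Rval rho i.+1 x + Phi0 i * Rval rho i x.

Section Coefficients.
Variables (rho rhob : par fam) (zeta xi : F).

Definition lam_minus x : F :=
  (coefA rho 0 - zeta * coefA rhob 0 - xi) * (lam rho x / coefA rho 0 + 1)
  + coefC rho 1.

Definition Phi1_minus i : F :=
  (coefA rho 0 - zeta * coefA rhob 0 - xi) * zeta ^- i
  * \prod_(1 <= k < i.+1) (coefA rho k / coefA rhob k.-1).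

Definition Phi0_minus i : F :=
  zeta ^+ i * coefC rho 1 * \prod_(1 <= k < i.+1) (coefC rhob k / coefC rho k).

Definition den1 i : F := Xc rho i.+1 - zeta ^+ 2 * Xc rhob i.
Definition den2 i : F := zeta * Yc rhob i - Yc rho i.+1 - xi.

Definition constraint1 i : F :=
  zeta ^+ i.*2 * ((zeta * Yc rhob i - Yc rho i - xi) / den1 i)
  * \prod_(1 <= k < i.+1) (Xc rhob k / Xc rho k).

Definition constraint2 i : F :=
  zeta ^+ i.*2
  * ((Xc rho i.+1 - zeta ^+ 2 * Xc rhob i.+1) / (den2 i * Xc rho i.+1))
  * \prod_(1 <= k < i.+1) (Xc rhob k / Xc rho k).

(* The second expression has the denominator X_{i+1}, which is 0 for
   i = size_of rho; hence the condition i < size_of rho. *)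
Definition constraints_A2 : Prop :=
  exists c : F,
    (forall i, (i <= size_of rhob)%N -> constraint1 i = c) /\
    (forall i, (i <= size_of rhob)%N -> (i < size_of rho)%N ->
       constraint2 i = c).

Definition generic_denominators : Prop :=
  (forall i, (i <= size_of rhob)%N -> den1 i != 0) /\
  (forall i, (i <= size_of rhob)%N -> (i < size_of rho)%N -> den2 i != 0).

Definition coefficients_up_to_scaling
    (lamm : int -> F) (Phi1 Phi0 : nat -> F) : Prop :=
  exists c : F, [/\ c != 0,
    forall x, on_grid (size_of rho) x -> lamm x = c * lam_minus x,
    forall i, (i <= size_of rhob)%N -> (i < size_of rho)%N ->
      Phi1 i = c * Phi1_minus i &
    forall i, (i <= size_of rhob)%N -> Phi0 i = c * Phi0_minus i].

End Coefficients.
End Family.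

(* Main.v *)
Require Import Defs.
From mathcomp Require Import all_boot all_order all_algebra.
From mathcomp Require Import ring zify.

Set Implicit Arguments.
Unset Strict Implicit.
Unset Printing Implicit Defensive.

Import GRing.Theory Num.Theory.
Local Open Scope ring_scope.

(** Write n and m for the sizes of rho and rhob, P_i(x) for R_i(x; rho), and
    Q_i(x) for R_i(x + eta; rhob).  The relation between the two spectral
    variables turns zeta times the three-term recurrence of Q_i into a relation
    for multiplication by lam rho x + xi.  Multiplying it by lamm x, inserting
    the contiguity relation for the indices i - 1, i, i + 1 and reducing with
    the recurrence of the P_j gives an identity
      a_i P_(i+2) + b_i P_(i+1) + c_i P_i + d_i P_(i-1) = 0,
    whose coefficients ([rel_up2], [rel_up1], [rel_diag], [rel_down]) are linear
    in Phi1 and Phi0; this computation is [recurrence_defect].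

    From contiguity to the constraints, the P_j are independent on the grid, so
    the four coefficients vanish.  The case i = m is delicate: the recurrence
    of Q_m is available only where x + eta is on the grid of rhob.  There
    [expansion_sparse] is used: a combination of the P_j with j >= k that
    vanishes on the grid outside a set S of at most k points is zero.  Indeed
    its product with the factors lam rho x - lam rho y, for y in S, vanishes on
    the whole grid, while each factor lowers the smallest index that occurs by
    exactly one, C_j being nonzero.  This applies with k = m - 1, since at most
    m - 1 points are lost.
    Then a_i = 0 and d_i = 0 are two-term recursions which determine Phi1 and
    Phi0 up to a common factor, c_0 = 0 links their initial values, and with
    Phi1 and Phi0 known, c_i = 0 and b_i = 0 become the two constraints
    ([constraint1P], [constraint2P]).  The common value of the constraints is
    forced to be [common_value], that of the first expression at i = 0.

    Conversely, the closed forms of Phi1 and Phi0 satisfy a_i = d_i = 0 by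
    construction, and the constraints give b_i = c_i = 0.  For i < m the
    recurrence of Q_i is a polynomial identity, valid at every x, in which
    Q_(i+1) has a nonzero coefficient; the contiguity relation thus
    propagates from the indices i - 1 and i to i + 1. *)

(** * The polynomials of one family on the grid *)

Section FiniteFamily.
Variables (F : fieldType) (fam : poly_family F) (rho : par fam).
Hypothesis hrho : finite_family_at rho.
Local Notation n := (size_of rho).
Local Notation A := (coefA rho).
Local Notation C := (Defs.coefC rho).

Lemma coefC_neq0 i : (0 < i <= n)%N -> C i != 0.
Proof. by move=> /(Xc_neq0 hrho); rewrite mulf_eq0 negb_or => /andP[]. Qed.

Lemma coefA_neq0 i : (i < n)%N -> A i != 0.
Proof.
by move=> /(@Xc_neq0 F fam rho hrho i.+1); rewrite mulf_eq0 negb_or => /andP[].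
Qed.

Lemma Rval0 x : Rval rho 0 x = 1.
Proof. by rewrite /Rval (poly_of_0 hrho) hornerC. Qed.

Lemma Rval_big i x : (n < i)%N -> Rval rho i x = 0.
Proof. by rewrite /Rval ltnNge => /negbTE ->. Qed.

Lemma on_grid_nat (x : nat) : on_grid n x%:Z = (x <= n)%N.
Proof. by rewrite /on_grid lez_nat. Qed.

(** The variable takes n + 1 distinct values on the grid, so a polynomial of
    degree at most n is determined by its values there. *)
Lemma poly_grid0 (p : {poly F}) :
  (size p <= n.+1)%N ->
  (forall x, on_grid n x -> p.[lam rho x] = 0) -> p = 0.
Proof.
move=> szp p0; pose s := [seq lam rho k%:Z | k <- iota 0 n.+1].
have memP k : (k \in iota 0 n.+1) = (k <= n)%N by rewrite mem_iota add0n ltnS.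
apply: (@roots_geq_poly_eq0 _ p s).
- apply/allP => y /mapP[k]; rewrite memP => kn ->.
  by apply/rootP/p0; rewrite on_grid_nat.
- rewrite map_inj_in_uniq ?iota_uniq // => k l; rewrite !memP => kn ln e.
  by have [] : k%:Z = l%:Z by apply: (lam_inj hrho); rewrite ?on_grid_nat.
- by rewrite size_map size_iota.
Qed.

(** Below the top index both sides of the recurrence have degree at most n, and
    the recurrence holds as an identity of polynomials, hence off the grid. *)
Lemma recurrence_poly i : (i < n)%N ->
  'X * poly_of rho i = A i *: poly_of rho i.+1
    - (A i + C i) *: poly_of rho i + C i *: poly_of rho i.-1.
Proof.
move=> lt_in; apply/eqP; rewrite -subr_eq0; apply/eqP/poly_grid0.
  have sz j : (j <= i.+1)%N -> (size (poly_of rho j) <= n.+1)%N.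
    by move=> ji; rewrite (size_poly_of hrho) //; lia.
  have szZ (a : F) j : (j <= i.+1)%N -> (size (a *: poly_of rho j) <= n.+1)%N.
    by move=> ji; apply: leq_trans (size_scale_leq _ _) (sz _ ji).
  rewrite (leq_trans (size_polyD _ _)) // geq_max size_polyN; apply/andP; split.
    rewrite mulrC (leq_trans (size_polyMleq _ _)) // size_polyX.
    by rewrite (size_poly_of hrho); lia.
  rewrite (leq_trans (size_polyD _ _)) // geq_max.
  rewrite (leq_trans (size_polyD _ _)) ?geq_max ?size_polyN /=.
    by rewrite szZ // (leq_trans (leq_pred _)).
  by rewrite !szZ.
move=> x gx; have := recurrence hrho (ltnW lt_in) gx.
rewrite /Rval lt_in (ltnW lt_in) (leq_trans (leq_pred _) (ltnW lt_in)) => e.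
by rewrite !hornerE e subrr.
Qed.

Lemma recurrence_lt i x : (i < n)%N ->
  lam rho x * Rval rho i x = A i * Rval rho i.+1 x
    - (A i + C i) * Rval rho i x + C i * Rval rho i.-1 x.
Proof.
move=> lt_in; rewrite /Rval lt_in (ltnW lt_in).
rewrite (leq_trans (leq_pred _) (ltnW lt_in)).
have /(congr1 (horner^~ (lam rho x))) := recurrence_poly lt_in.
by rewrite !hornerE.
Qed.

Lemma poly_of_free (m : nat) (f : nat -> F) : (m <= n.+1)%N ->
  \sum_(j < m) f j *: poly_of rho j = 0 -> forall j, (j < m)%N -> f j = 0.
Proof.
elim: m => // m IH mn; rewrite big_ord_recr /= => e.
have fm0 : f m = 0.
  have /(congr1 (fun p : {poly F} => p`_m)) := e.
  rewrite coefD coef0 coef_sum big1 ?add0r => [|j _]; last first.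
    rewrite coefZ nth_default ?mulr0 // (size_poly_of hrho);
    by have := ltn_ord j; lia.
  rewrite coefZ => /eqP; rewrite mulf_eq0 => /orP[/eqP //|].
  have szm := size_poly_of hrho (mn : (m <= n)%N).
  have := lead_coef_eq0 (poly_of rho m); rewrite lead_coefE szm /= => ->.
  by rewrite -size_poly_eq0 szm.
move: e; rewrite fm0 scale0r addr0 => /(IH (ltnW mn)) fj0 j.
by rewrite ltnS leq_eqVlt => /orP[/eqP -> //|/fj0].
Qed.

(** The function on the grid with coordinates [f] in the family R_0, ..., R_n;
    the values of [f] beyond n are ignored. *)
Definition expansion (f : nat -> F) x := \sum_(j < n.+1) f j * Rval rho j x.

Lemma expansion_free f : (forall x, on_grid n x -> expansion f x = 0) ->
  forall j, (j <= n)%N -> f j = 0.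
Proof.
move=> f0; apply: (@poly_of_free n.+1) => //; apply: poly_grid0.
  apply: (leq_trans (size_sum _ _ _)); apply/bigmax_leqP => j _.
  by rewrite (leq_trans (size_scale_leq _ _)) // (size_poly_of hrho) // -ltnS.
move=> x /f0 <-; rewrite horner_sum; apply: eq_bigr => j _.
by rewrite hornerZ /Rval -ltnS ltn_ord.
Qed.

(** Multiplication by lam rho x - lam rho y acts on the coordinates as a
    tridiagonal matrix; no R_(n+1) appears since A_n = 0. *)
Lemma expansion_mul f y x : on_grid n x ->
  (lam rho x - lam rho y) * expansion f x =
  expansion (fun j => (if j is j'.+1 then A j' * f j' else 0)
    + (- (A j + C j) - lam rho y) * f j
    + (if (j < n)%N then C j.+1 * f j.+1 else 0)) x.
Proof.
move=> gx; rewrite /expansion mulr_sumr.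
transitivity (\sum_(j < n.+1) (A j * f j * Rval rho j.+1 x
   + (- (A j + C j) - lam rho y) * f j * Rval rho j x
   + C j * f j * Rval rho j.-1 x)).
  apply: eq_bigr => j _; have jn : (j <= n)%N by rewrite -ltnS.
  by rewrite mulrCA mulrBl (recurrence hrho jn gx); ring.
under [in RHS]eq_bigr do rewrite mulrDl mulrDl.
rewrite !big_split /=; congr (_ + _ + _).
  rewrite big_ord_recr /= (coefA_N hrho) !mul0r addr0.
  by rewrite [RHS]big_ord_recl /= mul0r add0r.
rewrite big_ord_recl /= (coefC_0 hrho) !mul0r add0r.
rewrite [RHS]big_ord_recr /= ltnn mul0r addr0.
by apply: eq_bigr => j _; rewrite /bump /= ltn_ord.
Qed.

(** An expansion that starts at the index [size s] and vanishes on the grid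
    outside the points of [s] is zero. *)
Lemma expansion_sparse (s : seq int) f :
  (forall j, (j < size s)%N -> f j = 0) ->
  (forall x, on_grid n x -> x \notin s -> expansion f x = 0) ->
  forall j, (j <= n)%N -> f j = 0.
Proof.
elim: s f => [|y s IH] f f0 fs; first by apply: expansion_free => x /fs ->.
set g := fun j => (if j is j'.+1 then A j' * f j' else 0)
    + (- (A j + C j) - lam rho y) * f j
    + (if (j < n)%N then C j.+1 * f j.+1 else 0).
have g0 j : (j <= n)%N -> g j = 0.
  apply: IH => [{}j js|x gx xs].
    rewrite /g (f0 j) 1?(f0 j.+1) ?mulr0 ?addr0 //=; last by rewrite ltnW.
    rewrite if_same addr0; case: j js => // j js.
    by rewrite f0 ?mulr0 //= (ltn_trans (ltnSn _)) // ltnW.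
  rewrite -expansion_mul //; have [->|xy] := eqVneq x y.
    by rewrite subrr mul0r.
  by rewrite fs ?mulr0 // inE negb_or xy.
(* As g_j = 0 expresses f_(j+1) in terms of f_j and f_(j-1), through the nonzero
   coefficient C_(j+1), the coordinates vanish one after the other from f_0. *)
suff ff j : (j <= n)%N -> f j = 0 /\ f j.-1 = 0 by move=> j /ff[].
elim: j => [|j IHj] jn; first by rewrite f0.
have [fj0 fj'0] := IHj (ltnW jn); split => //.
have := g0 _ (ltnW jn); rewrite /g jn fj0 mulr0 addr0.
have -> : (if j is j'.+1 then A j' * f j' else 0) = 0.
  by case: j fj'0 {IHj jn fj0} => //= j ->; rewrite mulr0.
rewrite add0r => /eqP; rewrite mulf_eq0 => /orP[|/eqP //].
by rewrite (negbTE (coefC_neq0 _)).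
Qed.

Lemma expansion1 k x : expansion (fun j => (j == k)%:R) x = Rval rho k x.
Proof.
rewrite /expansion; have [kn|nk] := leqP k n; last first.
  rewrite Rval_big // big1 // => j _.
  by rewrite (_ : (j == k :> nat) = false) ?mul0r //; have := ltn_ord j; lia.
rewrite (bigD1 (Ordinal (kn : k < n.+1)%N)) //= eqxx mul1r big1 ?addr0 // => j.
by rewrite -val_eqE /= => /negbTE ->; rewrite mul0r.
Qed.

Lemma expansionZD f g a x :
  expansion (fun j => a * f j + g j) x = a * expansion f x + expansion g x.
Proof.
rewrite /expansion mulr_sumr -big_split /=; apply: eq_bigr => j _.
by rewrite mulrDl mulrA.
Qed.

(** Four consecutive members of the family are independent on the whole grid,
    or outside fewer than i of its points, as far as they are present:
    R_(i+1) and R_(i+2) may exceed the size of the family, and for i = 0 the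
    index i - 1 is truncated to 0, whence the condition on [d]. *)
Lemma four_term (s : seq int) i a b c d :
  (size s < i)%N || nilp s -> (i = 0%N -> d = 0) -> (i <= n)%N ->
  (forall x, on_grid n x -> x \notin s ->
     a * Rval rho i.+2 x + b * Rval rho i.+1 x
     + c * Rval rho i x + d * Rval rho i.-1 x = 0) ->
  [/\ (i.+1 < n)%N -> a = 0, (i < n)%N -> b = 0, c = 0 & d = 0].
Proof.
move=> hs hd i_n H.
(* The final 0 gives each of the four terms the shape of [expansionZD]. *)
pose f j := a * (j == i.+2)%:R + (b * (j == i.+1)%:R
  + (c * (j == i)%:R + (d * (j == i.-1)%:R + 0))).
have f0 j : (j <= n)%N -> f j = 0.
  apply: (@expansion_sparse s) => [{}j js|x gx xs].
    have hs' : (size s < i)%N by case/orP: hs => // /nilP e; rewrite e in js.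
    rewrite /f.
    by do 4![rewrite (_ : (j == _) = false) ?mulr0 ?add0r //; last by lia].
  rewrite /f !expansionZD !expansion1 [X in _ + (_ + (_ + (_ + X)))]big1.
    by rewrite addr0 !addrA H.
  by move=> ? _; rewrite mul0r.
have E k : (k <= n)%N -> f k = 0 by apply: f0.
have d0 : d = 0.
  case: i hd i_n {hs H f0} @f E => [/(_ erefl) //|i _ i_n] f E.
  have := E i (ltnW i_n); rewrite /f /= eqxx.
  by do 3![rewrite (_ : (i == _) = false) ?mulr0 ?add0r; last lia];
     rewrite mulr1 addr0.
have fE k : (k <= n)%N ->
    a * (k == i.+2)%:R + b * (k == i.+1)%:R + c * (k == i)%:R = 0.
  by move=> /E; rewrite /f d0 mul0r !addr0 !addrA.
split => // [/fE|/fE|]; last move: (fE _ i_n);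
  by rewrite eqxx;
     do 2![rewrite (_ : (_ == _) = false) ?mulr0 ?add0r ?addr0; last lia];
     rewrite mulr1.
Qed.

End FiniteFamily.

(** * The coefficients and the constraints *)

Section Contiguity.
Variables (F : fieldType) (fam : poly_family F) (rho rhob : par fam).
Variables (eta : int) (zeta xi : F).
Hypothesis hrho : finite_family_at rho.
Hypothesis hrhob : finite_family_at rhob.
Hypothesis hlam : forall x : int, on_grid (size_of rho) x ->
  lam rho x = zeta * lam rhob (x + eta) - xi.
Hypothesis hN : (size_of rhob <= size_of rho)%N.
Hypothesis hpos : (0 < size_of rhob)%N.

Local Notation n := (size_of rho).
Local Notation m := (size_of rhob).
Local Notation A := (coefA rho).
Local Notation C := (Defs.coefC rho).
Local Notation Ab := (coefA rhob).
Local Notation Cb := (Defs.coefC rhob).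
Local Notation Phi1m := (Phi1_minus rho rhob zeta xi).
Local Notation Phi0m := (Phi0_minus rho rhob zeta).

Lemma zeta_neq0 : zeta != 0.
Proof.
have n0 := leq_trans hpos hN; apply/eqP => z0.
have g0 : on_grid n 0 by rewrite on_grid_nat.
have g1 : on_grid n 1 by rewrite on_grid_nat.
by have := lam_inj hrho g0 g1; rewrite !hlam // z0 !mul0r => /(_ erefl).
Qed.
#[local] Hint Resolve zeta_neq0 : core.

Lemma A0_neq0 : A 0 != 0.
Proof. exact: (coefA_neq0 hrho (leq_trans hpos hN)). Qed.
#[local] Hint Resolve A0_neq0 : core.

Lemma C1_neq0 : C 1 != 0.
Proof. exact: (@coefC_neq0 _ _ _ hrho 1 (leq_trans hpos hN)). Qed.
#[local] Hint Resolve C1_neq0 : core.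

Lemma Phi0_minus_0 : Phi0m 0 = C 1.
Proof. by rewrite /Phi0_minus big_geq // mul1r mulr1. Qed.

Lemma Phi1_minus_0 : Phi1m 0 = A 0 - zeta * Ab 0 - xi.
Proof. by rewrite /Phi1_minus big_geq // expr0 invr1 !mulr1. Qed.

Lemma Phi0_minusS i : Phi0m i.+1 = zeta * (Cb i.+1 / C i.+1) * Phi0m i.
Proof. by rewrite /Phi0_minus big_nat_recr //= exprS; ring. Qed.

Lemma Phi1_minusS i : Phi1m i.+1 = A i.+1 / (zeta * Ab i) * Phi1m i.
Proof. by rewrite /Phi1_minus big_nat_recr //= exprS !invfM; ring. Qed.

Lemma Phi0_minus_neq0 i : (i <= m)%N -> Phi0m i != 0.
Proof.
elim: i => [|i IH] im; first by rewrite Phi0_minus_0.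
rewrite Phi0_minusS mulf_neq0 ?IH ?(ltnW im) // mulf_neq0 // mulf_neq0 //.
  by rewrite (coefC_neq0 hrhob).
by rewrite invr_eq0 (coefC_neq0 hrho) //= (leq_trans im).
Qed.

(** The factor zeta^(2i) times the product of the ratios of the X_k, common to
    both constraints. *)
Definition weight i :=
  zeta ^+ i.*2 * \prod_(1 <= k < i.+1) (Xc rhob k / Xc rho k).

(** The value of the first constraint at i = 0. *)
Definition common_value := (A 0 - zeta * Ab 0 - xi) / (A 0 * C 1).

Lemma weightS i :
  weight i.+1 = zeta ^+ 2 * (Xc rhob i.+1 / Xc rho i.+1) * weight i.
Proof. by rewrite /weight big_nat_recr //= doubleS -addn2 exprD; ring. Qed.

Lemma weight_neq0 i : (i <= m)%N -> weight i != 0.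
Proof.
elim: i => [|i IH] im; first by rewrite /weight big_geq // mulr1 oner_neq0.
rewrite weightS; apply: mulf_neq0 (IH (ltnW im)).
apply: mulf_neq0; first exact: expf_neq0.
apply: mulf_neq0; first exact: (@Xc_neq0 _ _ _ hrhob i.+1).
rewrite invr_eq0; apply: (@Xc_neq0 _ _ _ hrho i.+1).
exact: leq_trans im hN.
Qed.

(** The ratio of Phi1_i to Phi0_i is A_i [common_value] / [weight i]; this is
    what connects the contiguity coefficients with the constraints. *)
Lemma Phi1_minus_ratio i : (i <= m)%N ->
  Phi1m i = A i * (common_value / weight i) * Phi0m i.
Proof.
elim: i => [|i IH] im.
  rewrite Phi1_minus_0 Phi0_minus_0 /weight big_geq // expr0 mulr1.
  rewrite /common_value.
  by field; rewrite oner_neq0 A0_neq0 C1_neq0.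
have W := weight_neq0 (ltnW im).
have Ai : A i != 0 by rewrite (coefA_neq0 hrho) // (leq_trans im).
have Abi : Ab i != 0 by rewrite (coefA_neq0 hrhob).
have Ci : C i.+1 != 0 by rewrite (coefC_neq0 hrho) //= (leq_trans im).
have Cbi : Cb i.+1 != 0 by rewrite (coefC_neq0 hrhob).
rewrite Phi1_minusS Phi0_minusS weightS IH ?(ltnW im) // /Xc /=.
by field; rewrite W Ai Abi Ci Cbi zeta_neq0.
Qed.

(** Expressed through Phi0_(i+1) instead, Phi1_i carries the nonzero coefficient
    A_i of rhob, and not A_(i+1), which vanishes when i + 1 = n. *)
Lemma Phi1_minus_ratio_pred i : (i < m)%N ->
  Phi1m i = zeta * Ab i * (common_value / weight i.+1) * Phi0m i.+1.
Proof.
move=> im; have W := weight_neq0 (ltnW im).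
have Ai : A i != 0 by rewrite (coefA_neq0 hrho) // (leq_trans im).
have Abi : Ab i != 0 by rewrite (coefA_neq0 hrhob).
have Ci : C i.+1 != 0 by rewrite (coefC_neq0 hrho) //= (leq_trans im).
have Cbi : Cb i.+1 != 0 by rewrite (coefC_neq0 hrhob).
rewrite (Phi1_minus_ratio (ltnW im)) Phi0_minusS weightS /Xc /=.
by field; rewrite W Ai Abi Ci Cbi zeta_neq0.
Qed.

(** [rel_up2], [rel_up1], [rel_diag] and [rel_down] are the coefficients of
    R_(i+2), R_(i+1), R_i and R_(i-1) at rho that remain when the contiguity
    relation is inserted in the recurrence of R_i at rhob.  At i = 0 the
    truncated index i - 1 is harmless, both C_0 being 0. *)
Definition rel_up2 (Phi1 : nat -> F) i :=
  zeta * Ab i * Phi1 i.+1 - A i.+1 * Phi1 i.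
Definition rel_up1 (Phi1 Phi0 : nat -> F) i :=
  zeta * (Ab i * Phi0 i.+1 + Yc rhob i * Phi1 i)
  - (Yc rho i.+1 + xi) * Phi1 i - A i * Phi0 i.
Definition rel_diag (Phi1 Phi0 : nat -> F) i :=
  zeta * (Yc rhob i * Phi0 i + Cb i * Phi1 i.-1)
  - C i.+1 * Phi1 i - (Yc rho i + xi) * Phi0 i.
Definition rel_down (Phi0 : nat -> F) i :=
  zeta * Cb i * Phi0 i.-1 - C i * Phi0 i.

Lemma constraint1_0 : constraint1 rho rhob zeta xi 0 = common_value.
Proof.
rewrite /constraint1 big_geq // expr0 mulr1 mul1r /den1 /Xc /Yc /=.
rewrite (coefC_0 hrho) (coefC_0 hrhob) /common_value !mulr0 !addr0 subr0.
by congr (_ / _); ring.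
Qed.

(** With U the numerator of the first constraint, both sides say that
    U = den1 * common_value / weight. *)
Lemma constraint1P i : (i <= m)%N -> den1 rho rhob zeta i != 0 ->
  constraint1 rho rhob zeta xi i = common_value <-> rel_diag Phi1m Phi0m i = 0.
Proof.
move=> im D0; have W := weight_neq0 im.
set U := zeta * Yc rhob i - Yc rho i - xi.
set V := U - den1 rho rhob zeta i * (common_value / weight i).
have -> : rel_diag Phi1m Phi0m i = Phi0m i * V.
  have e : Cb i * Phi1m i.-1 =
      Cb i * (zeta * Ab i.-1 * (common_value / weight i) * Phi0m i).
    case: i im {D0 W U V} => [|i] im; first by rewrite (coefC_0 hrhob) !mul0r.
    by rewrite Phi1_minus_ratio_pred.
  by rewrite /rel_diag /V /U e (Phi1_minus_ratio im) /den1 /Xc /=; ring.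
have e1 : constraint1 rho rhob zeta xi i - common_value =
          weight i / den1 rho rhob zeta i * V.
  rewrite /constraint1 -mulrA [_ / _ * \prod_(_ <= _ < _) _]mulrC mulrA.
  by rewrite -/(weight i) -/U /V; field; rewrite W D0.
split=> [/eqP|/eqP].
  rewrite -subr_eq0 e1 mulf_eq0 mulf_eq0 invr_eq0 (negbTE W) (negbTE D0) /=.
  by move/eqP->; rewrite mulr0.
rewrite mulf_eq0 (negbTE (Phi0_minus_neq0 im)) => /eqP V0.
by apply/eqP; rewrite -subr_eq0 e1 V0 mulr0.
Qed.

(** Both sides say that den2 * X_(i+1) * common_value / weight equals the
    numerator of the second constraint. *)
Lemma constraint2P i : (i <= m)%N -> (i < n)%N ->
  den2 rho rhob zeta xi i != 0 ->
  constraint2 rho rhob zeta xi i = common_value <->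
  rel_up1 Phi1m Phi0m i = 0.
Proof.
move=> im i_n D0; have W := weight_neq0 im.
have Ai : A i != 0 by rewrite (coefA_neq0 hrho).
have Ci : C i.+1 != 0 by rewrite (coefC_neq0 hrho).
have X0 : Xc rho i.+1 != 0 by apply: (@Xc_neq0 _ _ _ hrho i.+1).
set V := den2 rho rhob zeta xi i * Xc rho i.+1 * (common_value / weight i)
  - (Xc rho i.+1 - zeta ^+ 2 * Xc rhob i.+1).
have -> : rel_up1 Phi1m Phi0m i = Phi0m i / C i.+1 * V.
  rewrite /rel_up1 /V (Phi1_minus_ratio im) Phi0_minusS /den2 /Xc /=.
  by field; rewrite W Ci.
have e1 : constraint2 rho rhob zeta xi i - common_value =
          - (weight i / (den2 rho rhob zeta xi i * Xc rho i.+1) * V).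
  rewrite /constraint2 -mulrA [_ / _ * \prod_(_ <= _ < _) _]mulrC mulrA.
  by rewrite -/(weight i) /V; field; rewrite W D0 X0.
split=> [/eqP|/eqP].
  rewrite -subr_eq0 e1 oppr_eq0 mulf_eq0 mulf_eq0 (negbTE W).
  rewrite invr_eq0 mulf_eq0 (negbTE D0) (negbTE X0) /=.
  by move/eqP->; rewrite mulr0.
rewrite mulf_eq0 mulf_eq0 invr_eq0 (negbTE (Phi0_minus_neq0 im)) (negbTE Ci) /=.
by move=> /eqP V0; apply/eqP; rewrite -subr_eq0 e1 V0 mulr0 oppr0.
Qed.

(** * Contiguity and the recurrences *)

(** The contiguity relations at i - 1 and i turn the recurrence at rhob into a
    relation between the four remaining coefficients and the failure of
    contiguity at i + 1.  It is used in both directions: to obtain the vanishing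
    of the coefficients, and to obtain contiguity at i + 1. *)
Lemma recurrence_defect (lamm : int -> F) (Phi1 Phi0 : nat -> F) i x :
  (i <= m)%N -> ((n <= i)%N -> Phi1 i = 0) ->
  on_grid n x -> (i < m)%N || on_grid m (x + eta) ->
  (forall j, (j <= i)%N -> (i <= j.+1)%N ->
    lamm x * Rval rhob j (x + eta) =
    Phi1 j * Rval rho j.+1 x + Phi0 j * Rval rho j x) ->
  rel_up2 Phi1 i * Rval rho i.+2 x + rel_up1 Phi1 Phi0 i * Rval rho i.+1 x
  + rel_diag Phi1 Phi0 i * Rval rho i x + rel_down Phi0 i * Rval rho i.-1 x =
  zeta * Ab i * (Phi1 i.+1 * Rval rho i.+2 x + Phi0 i.+1 * Rval rho i.+1 x
                 - lamm x * Rval rhob i.+1 (x + eta)).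
Proof.
move=> im hPhi gx hx H.
have hq := H i (leqnn i) (leqnSn i).
have hqm : Cb i * (lamm x * Rval rhob i.-1 (x + eta)) =
    Cb i * (Phi1 i.-1 * Rval rho i x + Phi0 i.-1 * Rval rho i.-1 x).
  case: i H {im hPhi hx hq} => [|i] H; first by rewrite (coefC_0 hrhob) !mul0r.
  by rewrite (H i).
have recb : lam rhob (x + eta) * Rval rhob i (x + eta) =
    Ab i * Rval rhob i.+1 (x + eta) - (Ab i + Cb i) * Rval rhob i (x + eta)
    + Cb i * Rval rhob i.-1 (x + eta).
  case/orP: hx => hx; first exact: recurrence_lt.
  exact: recurrence.
have rec0 := recurrence hrho (leq_trans im hN) gx.
have rec1 : Phi1 i * (lam rho x * Rval rho i.+1 x) =
    Phi1 i * (A i.+1 * Rval rho i.+2 x - (A i.+1 + C i.+1) * Rval rho i.+1 x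
    + C i.+1 * Rval rho i x).
  have [/hPhi->|i_n] := leqP n i; first by rewrite !mul0r.
  by rewrite (recurrence hrho i_n gx).
have hl := hlam gx.
apply/eqP; rewrite -subr_eq0; apply/eqP.
set q := Rval rhob i _ in hq recb *; set q1 := Rval rhob i.+1 _ in recb *.
set qm := Rval rhob i.-1 _ in recb hqm.
set p2 := Rval rho i.+2 _ in rec1 *.
set p1 := Rval rho i.+1 _ in hq rec0 rec1 *.
set p := Rval rho i _ in hq hqm rec0 rec1 *.
set pm := Rval rho i.-1 _ in hqm rec0 *.
set w := lamm x in hq hqm *; set L := lam rho x in rec0 rec1 hl.
set Lb := lam rhob _ in recb hl.
(* Each of the six summands is a multiple of left minus right side in one of
   the relations hqm, hq, recb, hl, rec1, rec0. *)
transitivity (zeta * (Cb i * (Phi1 i.-1 * p + Phi0 i.-1 * pm) - Cb i * (w * qm))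
  + (L + xi - zeta * Yc rhob i) * (w * q - (Phi1 i * p1 + Phi0 i * p))
  + zeta * w * (Ab i * q1 - (Ab i + Cb i) * q + Cb i * qm - Lb * q)
  + w * q * (zeta * Lb - xi - L)
  + (Phi1 i * (L * p1)
     - Phi1 i * (A i.+1 * p2 - (A i.+1 + C i.+1) * p1 + C i.+1 * p))
  + Phi0 i * (L * p - (A i * p1 - (A i + C i) * p + C i * pm))).
  by rewrite /rel_up2 /rel_up1 /rel_diag /rel_down /Yc; ring.
by rewrite hqm hq recb rec1 rec0 -hl !subrr !mulr0 !addr0.
Qed.


Hypothesis hlost : (lost_points rho rhob eta < m)%N.

Lemma lost_listP : exists s : seq int, (size s < m)%N /\
  forall x, on_grid n x -> x \notin s -> on_grid m (x + eta).
Proof.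
pose S := [set x : 'I_n.+1 | ~~ on_grid m (x%:Z + eta)].
exists [seq (val x)%:Z | x <- enum S]; split; first by rewrite size_map -cardE.
case=> [x|x]; last by rewrite /on_grid.
rewrite on_grid_nat => xn; apply: contraNT => bad; apply/mapP.
by exists (Ordinal (xn : x < n.+1)%N); rewrite // mem_enum inE.
Qed.

(** For i = m the recurrence at rhob fails at the lost points only, and these
    are fewer than m; contiguity at i + 1 = m + 1 is not needed as the
    coefficient A_m at rhob is 0. *)
Lemma contiguity_rels lamm Phi1 Phi0 i : (i <= m)%N ->
  ((n <= i)%N -> Phi1 i = 0) -> contiguity rho rhob eta lamm Phi1 Phi0 ->
  [/\ (i.+1 < n)%N -> rel_up2 Phi1 i = 0, (i < n)%N -> rel_up1 Phi1 Phi0 i = 0,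
      rel_diag Phi1 Phi0 i = 0 & rel_down Phi0 i = 0].
Proof.
move=> im hPhi H; have [s ss hs] : exists2 s : seq int,
    (size s < i)%N || nilp s &
    forall x, on_grid n x -> x \notin s -> (i < m)%N || on_grid m (x + eta).
  have [lt_im|] := boolP (i < m)%N; first by exists [::]; rewrite ?orbT.
  rewrite -leqNgt => mi; have [s [ss hs]] := lost_listP.
  by exists s; [rewrite (leq_trans ss)|].
apply: four_term ss _ (leq_trans im hN) _ => //.
  by move=> ->; rewrite /rel_down (coefC_0 hrhob) (coefC_0 hrho); ring.
move=> x gx xs.
rewrite (@recurrence_defect lamm _ _ _ _ im hPhi gx (hs x gx xs)) => [|j ji _];
  last first.
  by apply: H => //; apply: leq_trans ji im.
have [lt_im|mi] := ltnP i m; first by rewrite (H i.+1) // subrr mulr0.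
have -> : i = m by apply/eqP; rewrite eqn_leq im.
by rewrite (coefA_N hrhob) mulr0 mul0r.
Qed.

Lemma Rval1 x : on_grid n x -> Rval rho 1 x = lam rho x / A 0 + 1.
Proof.
move=> gx; have := recurrence hrho (leq0n _) gx.
rewrite !(Rval0 hrho) (coefC_0 hrho) => e.
apply: (mulfI A0_neq0); rewrite mulrDr mulrCA divff // !mulr1.
by rewrite -[lam _ _]mulr1 e; ring.
Qed.

Lemma rel_diag0 Phi1 Phi0 : rel_diag Phi1 Phi0 0 = 0 ->
  C 1 * Phi1 0%N = (A 0 - zeta * Ab 0 - xi) * Phi0 0%N.
Proof.
rewrite /rel_diag /Yc (coefC_0 hrhob) (coefC_0 hrho) => e.
by apply/eqP; rewrite -subr_eq0 -oppr_eq0 -e; apply/eqP; ring.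
Qed.

(** Since Phi1_i multiplies R_(i+1) = 0 for i >= n, it may be assumed to vanish
    there. *)
Lemma contiguity_coefficients lamm Phi1 Phi0 :
  (forall i, (n <= i)%N -> Phi1 i = 0) -> Phi0 0%N != 0 ->
  contiguity rho rhob eta lamm Phi1 Phi0 ->
  let c := Phi0 0%N / C 1 in
  [/\ forall i, (i <= m)%N -> Phi0 i = c * Phi0m i,
      forall i, (i <= m)%N -> Phi1 i = c * Phi1m i
    & forall x, on_grid n x -> lamm x = c * lam_minus rho rhob zeta xi x].
Proof.
move=> hPhi P0 H c; have R i im := @contiguity_rels _ _ _ i im (hPhi i) H.
have e0 i : (i <= m)%N -> Phi0 i = c * Phi0m i.
  elim: i => [|i IH] im; first by rewrite Phi0_minus_0 /c divfK.
  have [_ _ _ /eqP] := R _ im; rewrite /rel_down subr_eq0 /= IH ?(ltnW im) //.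
  have Ci : C i.+1 != 0 by rewrite (coefC_neq0 hrho) //= (leq_trans im).
  by move=> /eqP e; apply: (mulfI Ci); rewrite -e Phi0_minusS; field.
have e10 : Phi1 0%N = c * Phi1m 0.
  have [_ _ /rel_diag0 e _] := R _ (leq0n _).
  by apply: (mulfI C1_neq0); rewrite e Phi1_minus_0 /c; field.
have e1 i : (i <= m)%N -> Phi1 i = c * Phi1m i.
  elim: i => [|i IH] im //; have [ni|i_n] := leqP n i.+1.
    have e : i.+1 = n by apply/eqP; rewrite eqn_leq ni (leq_trans im).
    by rewrite hPhi // Phi1_minusS e (coefA_N hrho) !mul0r mulr0.
  have [/(_ i_n)/eqP + _ _ _] := R _ (ltnW im).
  have Abi : Ab i != 0 by rewrite (coefA_neq0 hrhob).
  rewrite /rel_up2 subr_eq0 IH ?(ltnW im) // => /eqP e.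
  apply: (mulfI (mulf_neq0 zeta_neq0 Abi)); rewrite e Phi1_minusS.
  by field; rewrite Abi zeta_neq0.
split=> // x gx; have := H 0%N x (leq0n _) gx.
rewrite (Rval0 hrhob) (Rval0 hrho) (Rval1 gx) !mulr1 => ->.
by rewrite e0 // e1 // Phi0_minus_0 Phi1_minus_0 /lam_minus; ring.
Qed.

Hypothesis hden : generic_denominators rho rhob zeta xi.

Lemma contiguity_constraints lamm Phi1 Phi0 :
  (forall i, (n <= i)%N -> Phi1 i = 0) -> Phi0 0%N != 0 ->
  contiguity rho rhob eta lamm Phi1 Phi0 ->
  constraints_A2 rho rhob zeta xi.
Proof.
move=> hPhi P0 H; have [e0 e1 _] := contiguity_coefficients hPhi P0 H.
have R i im := @contiguity_rels _ _ _ i im (hPhi i) H.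
set c := Phi0 0%N / C 1 in e0 e1.
have c0 : c != 0 by rewrite mulf_neq0 // invr_eq0.
exists common_value; split=> i im.
  apply/constraint1P => //; first exact: hden.1.
  have [_ _ + _] := R _ im; rewrite /rel_diag e0 //.
  rewrite !e1 ?(leq_trans (leq_pred _)) //.
  move=> e; apply: (mulfI c0); rewrite mulr0 -[RHS]e; ring.
move=> i_n; apply/constraint2P => //; first exact: hden.2.
have [_ /(_ i_n) + _ _] := R _ im; rewrite /rel_up1 (e0 i) // e1 //.
(* Phi0_(m+1) is unconstrained but multiplied by 0 when i = m. *)
have -> : Ab i * Phi0 i.+1 = Ab i * (c * Phi0m i.+1).
  have [lt_im|mi] := ltnP i m; first by rewrite e0.
  have -> : i = m by apply/eqP; rewrite eqn_leq im.
  by rewrite (coefA_N hrhob) !mul0r.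
by move=> e; apply: (mulfI c0); rewrite mulr0 -[RHS]e; ring.
Qed.

Lemma constraints_contiguity : constraints_A2 rho rhob zeta xi ->
  contiguity rho rhob eta (lam_minus rho rhob zeta xi) Phi1m Phi0m.
Proof.
case=> c [K1 K2].
have c0 : c = common_value by rewrite -(K1 0%N) ?constraint1_0.
rewrite {}c0 in K1 K2.
suff H i x : (i <= m)%N -> on_grid n x -> forall j, (j <= i)%N ->
    lam_minus rho rhob zeta xi x * Rval rhob j (x + eta) =
    Phi1m j * Rval rho j.+1 x + Phi0m j * Rval rho j x.
  by move=> i x im gx; apply: (H i x im gx).
move=> + gx; elim: i => [_ [|//] _|i IH im j].
  rewrite (Rval0 hrhob) (Rval0 hrho) (Rval1 gx) Phi0_minus_0 Phi1_minus_0.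
  by rewrite /lam_minus !mulr1.
rewrite leq_eqVlt => /orP[/eqP->|]; last exact: IH (ltnW im) j.
have i_n : (i < n)%N := leq_trans im hN.
have Abi : Ab i != 0 by rewrite (coefA_neq0 hrhob).
have up2 : rel_up2 Phi1m i = 0.
  by rewrite /rel_up2 Phi1_minusS; field; rewrite Abi zeta_neq0.
have up1 : rel_up1 Phi1m Phi0m i = 0.
  by apply/constraint2P; rewrite ?K2 ?(ltnW im) //;
     apply: hden.2; rewrite // ltnW.
have diag : rel_diag Phi1m Phi0m i = 0.
  by apply/constraint1P; rewrite ?K1 ?(ltnW im) //; apply: hden.1; rewrite ltnW.
have down : rel_down Phi0m i = 0.
  case: i {IH im Abi up2 up1 diag} i_n => [|i] i_n.
    by rewrite /rel_down (coefC_0 hrhob) (coefC_0 hrho) mulr0 !mul0r subrr.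
  have Ci : C i.+1 != 0 by rewrite (coefC_neq0 hrho) //= ltnW.
  by rewrite /rel_down Phi0_minusS /=; field.
have hPhi : (n <= i)%N -> Phi1m i = 0 by rewrite leqNgt i_n.
have hx : (i < m)%N || on_grid m (x + eta) by rewrite im.
have := recurrence_defect (ltnW im) hPhi gx hx (fun j ji _ => IH (ltnW im) j ji).
rewrite up2 up1 diag down !mul0r !addr0 => /esym/eqP.
rewrite mulf_eq0 (negbTE (mulf_neq0 zeta_neq0 Abi)) subr_eq0 => /eqP ->.
by [].
Qed.

End Contiguity.

(** * The equivalence *)

Theorem proposition2p3 (F : fieldType) (fam : poly_family F)
  (rho rhob : par fam) (eta : int) (zeta xi : F)
  (hrho : finite_family_at rho) (hrhob : finite_family_at rhob)
  (heta : [\/ eta = 0, eta = 1 | eta = -1])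
  (hlam : forall x : int, on_grid (size_of rho) x ->
     lam rho x = zeta * lam rhob (x + eta) - xi)
  (hN : (size_of rhob <= size_of rho)%N)
  (hlost : (lost_points rho rhob eta < size_of rhob)%N)
  (hden : generic_denominators rho rhob zeta xi) :
  (forall (lamm : int -> F) (Phi1 Phi0 : nat -> F),
     (contiguity rho rhob eta lamm Phi1 Phi0 /\ Phi0 0%N != 0) <->
     (coefficients_up_to_scaling rho rhob zeta xi lamm Phi1 Phi0 /\
      constraints_A2 rho rhob zeta xi)) /\
  ((exists (lamm : int -> F) (Phi1 Phi0 : nat -> F),
      contiguity rho rhob eta lamm Phi1 Phi0 /\ Phi0 0%N != 0) <->
   constraints_A2 rho rhob zeta xi).
Proof.
have hpos : (0 < size_of rhob)%N by apply: leq_ltn_trans hlost.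
have fwd lamm Phi1 Phi0 :
    contiguity rho rhob eta lamm Phi1 Phi0 -> Phi0 0%N != 0 ->
    coefficients_up_to_scaling rho rhob zeta xi lamm Phi1 Phi0 /\
    constraints_A2 rho rhob zeta xi.
  move=> H P0.
  (* Phi1_i is unconstrained for i >= n and is replaced by 0 there. *)
  pose Phi1' i := if (i < size_of rho)%N then Phi1 i else 0.
  have z i : (size_of rho <= i)%N -> Phi1' i = 0.
    by rewrite /Phi1' leqNgt => /negbTE->.
  have H' : contiguity rho rhob eta lamm Phi1' Phi0.
    move=> i x im gx; rewrite H // /Phi1'; case: ltnP => // ni.
    by rewrite Rval_big ?mulr0 ?mul0r.
  split; last first.
    exact: (contiguity_constraints hrho hrhob hlam hN hpos hlost hden z P0 H').
  have [e0 e1 el] :=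
    contiguity_coefficients hrho hrhob hlam hN hpos hlost z P0 H'.
  exists (Phi0 0%N / Defs.coefC rho 1); split => //.
    by rewrite mulf_neq0 // invr_eq0 (C1_neq0 hrho hN hpos).
  by move=> i im i_n; rewrite -e1 // /Phi1' i_n.
have bwd := constraints_contiguity hrho hrhob hlam hN hpos hden.
have P0 := Phi0_minus_neq0 hrho hrhob hlam hN hpos (leq0n _).
split=> [lamm Phi1 Phi0|].
  split=> [[H /fwd]|[[c [c0 el e1 e0]] K]]; first exact.
  split=> [i x im gx|]; last by rewrite e0 // mulf_neq0.
  rewrite el // e0 // -mulrA (bwd K i x im gx).
  have [i_n|ni] := ltnP i (size_of rho); first by rewrite e1 //; ring.
  by rewrite (@Rval_big _ _ _ i.+1) //; ring.
split=> [[lamm [Phi1 [Phi0 [/fwd H /H[]]]]] //|K].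
by exists (lam_minus rho rhob zeta xi), (Phi1_minus rho rhob zeta xi),
  (Phi0_minus rho rhob zeta); split; [apply: bwd|].
Qed.
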